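(* Let $\Sigma$ be a non-empty signature (i.e. $\bigcup_{n\in\mathbb{N}}\Sigma_n\neq\emptyset$) and let $X$ be a set. There does not exist a $\Sigma$-multialgebra which satisfies the universal mapping property, for the class of all $\Sigma$-multialgebras, over $X$.
   Context: A signature is a family $\Sigma=\{\Sigma_n\}_{n\in\mathbb{N}}$ ($0\in\mathbb{N}$) of possibly empty sets; elements of $\Sigma_n$ are functional symbols of arity $n$. A $\Sigma$-multialgebra is a pair $\mathcal{A}=(A,\{\sigma_{\mathcal{A}}\}_{\sigma\in\Sigma})$ with $A$ a non-empty set and, for $\sigma\in\Sigma_n$, $\sigma_{\mathcal{A}}:A^n\to\mathcal{P}(A)\setminus\{\emptyset\}$ (for $\sigma\in\Sigma_0$, $\sigma_{\mathcal{A}}$ is identified with a non-empty subset of $A$). A homomorphism $f:\mathcal{A}\to\mathcal{B}$ is a function $f:A\to B$ with $\{f(a): a\in\sigma_{\mathcal{A}}(a_1,\ldots,a_n)\}\subseteq\sigma_{\mathcal{B}}(f(a_1),\ldots,f(a_n))$ for all $n$, $\sigma\in\Sigma_n$, $a_1,\ldots,a_n\in A$. A $\Sigma$-multialgebra $\mathcal{A}$ satisfies the universal mapping property for the class of all $\Sigma$-multialgebras over a set $X\subseteq A$ if, for every $\Sigma$-multialgebra $\mathcal{B}$ with universe $B$ and every map $f:X\to B$, there exists a unique homomorphism $\overline{f}:\mathcal{A}\to\mathcal{B}$ extending $f$. *)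

(* Defs.v *)
From mathcomp Require Import all_boot.
From mathcomp Require Import boolp classical_sets.

Set Implicit Arguments.
Unset Strict Implicit.
Unset Printing Implicit Defensive.

Local Open Scope classical_set_scope.

Definition signature := nat -> Type.

Definition nonempty_signature (Sigma : signature) : Prop :=
  exists n, inhabited (Sigma n).

(* For [n = 0] the type [0.-tuple A] has exactly one element, so a nullary
   symbol is interpreted by one non-empty subset of the carrier. *)
Record multialgebra (Sigma : signature) := Multialgebra {
  carrier :> Type;
  carrier_nonempty : inhabited carrier;
  mop : forall n, Sigma n -> n.-tuple carrier -> set carrier;
  mop_nonempty : forall n (s : Sigma n) (a : n.-tuple carrier), mop s a !=set0
}.

Definition is_homomorphism (Sigma : signature) (A B : multialgebra Sigma)
    (f : A -> B) : Prop :=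
  forall n (s : Sigma n) (a : n.-tuple A),
    f @` mop s a `<=` mop s (map_tuple f a).

(* The map [f] is defined on [X] only: [X] is coerced to [{x : A | x \in X}]. *)
Definition universal_mapping_property (Sigma : signature)
    (A : multialgebra Sigma) (X : set A) : Prop :=
  forall (B : multialgebra Sigma) (f : X -> B),
    exists! g : A -> B,
      is_homomorphism g /\ forall x : X, g (\val x) = f x.

(* Main.v *)
(** A universal [A] over [X] must equal [X]: every map into the two-element
    multialgebra whose operations return the whole carrier is a homomorphism, so
    uniqueness leaves no room for elements outside [X]. Every map out of [A] is
    then a homomorphism, but the constant [false] is not one into the
    two-element multialgebra whose operations all return [{true}]. *)
Require Import Defs.
From mathcomp Require Import all_boot.
From mathcomp Require Import boolp classical_sets.

Local Open Scope classical_set_scope.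

Definition bool_multialgebra (Sigma : signature) (V : set bool)
    (V0 : V !=set0) : multialgebra Sigma :=
  @Multialgebra Sigma bool (inhabits true) (fun _ _ _ => V) (fun _ _ _ => V0).

Lemma universal_mapping_property_setT (Sigma : signature)
    (A : multialgebra Sigma) (X : set A) :
  universal_mapping_property X -> X = setT.
Proof.
move=> umpX.
have T0 : [set: bool] !=set0 by exists true.
have [g [_ g_uniq]] := umpX (bool_multialgebra Sigma _ T0) (fun=> true).
have gT : g = fun=> true by apply: g_uniq; split.
(* The indicator of [X] also extends the constant [true] on [X], and any map into this target is a
   homomorphism. *)
have gX : g = fun x => x \in X.
  by apply: g_uniq; split=> // x; exact: valP x.
apply/seteqP; split=> // x _; apply/set_mem.
by rewrite -[x \in X]/((fun y => y \in X) x) -gX gT.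
Qed.

Lemma not_universal_mapping_property (Sigma : signature)
    (A : multialgebra Sigma) (X : set A) :
  nonempty_signature Sigma -> ~ universal_mapping_property X.
Proof.
move=> [n [s]] umpX.
have XT := universal_mapping_property_setT _ _ _ umpX.
have true0 : [set true] !=set0 by exists true.
have [g [[g_hom gX] _]] := umpX (bool_multialgebra Sigma _ true0) (fun=> false).
have [x] := carrier_nonempty A.
(* Any argument tuple serves; a constant one exists in every arity, 0 included. The value [y] must
   go to [true] under [g], yet lies in [X], where [g] is [false]. *)
have [y sy] := mop_nonempty s (nseq_tuple n x).
have Xy : y \in X by rewrite XT in_setT.
have /= gy : g y = true by apply: (g_hom n s (nseq_tuple n x)); exists y.
by have /= := gX (exist _ y Xy); rewrite gy.
Qed.

(** An abstract set [X] becomes a subset of the universe through an injection [i]. *)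
Theorem theorem9 (Sigma : signature) (hSigma : nonempty_signature Sigma)
    (X : Type) :
  ~ exists (A : multialgebra Sigma) (i : X -> A),
      injective i /\ universal_mapping_property (range i).
Proof.
by move=> [A [i [_]]]; exact: not_universal_mapping_property.
Qed.
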